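(* Let $G$ be a finite cyclic group of order $n\ge 2$ with generator $\gamma$, and let $d:G\to G$ be the univariate Diffie-Hellman mapping $d(\gamma^a)=\gamma^{a^2}$, $a=0,1,\ldots,n-1$. Then $$ind(d)=\begin{cases} n, & n \text{ odd},\\ n/2, & n \text{ even}.\end{cases}$$
   Context: For a positive divisor $\ell$ of $n$, let $C_{\ell,0}=\{\gamma^{j\ell}: j=0,1,\ldots,n/\ell-1\}$ (the subgroup of $\ell$-th powers, of index $\ell$ in $G$) and let $C_{\ell,i}=\gamma^i C_{\ell,0}$ for $i=0,1,\ldots,\ell-1$ (the cyclotomic cosets). For a positive integer $r$ and $a_0,\ldots,a_{\ell-1}\in G$, the $r$-th order cyclotomic mapping of index $\ell$ is the map $f^r_{a_0,\ldots,a_{\ell-1}}:G\to G$ given by $f^r_{a_0,\ldots,a_{\ell-1}}(x)=a_i x^r$ if $x\in C_{\ell,i}$, $i=0,\ldots,\ell-1$. For a self-mapping $f$ of $G$, $ind(f)$ denotes the smallest positive divisor $\ell$ of $n$ such that $f=f^r_{a_0,\ldots,a_{\ell-1}}$ for some positive integer $r$ and some $a_0,\ldots,a_{\ell-1}\in G$. *)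

(* Defs.v *)
From mathcomp Require Import all_boot all_fingroup.
From mathcomp Require Import boolp.

Set Implicit Arguments.
Unset Strict Implicit.
Unset Printing Implicit Defensive.

Local Open Scope group_scope.

(* The cyclic group is the whole type gT, generated by gamma; its order is
   #|gT|. *)

Definition cyclotomic_coset0 (gT : finGroupType) (gamma : gT) (l : nat) :
    {set gT} :=
  [set gamma ^+ (j * l)%N | j : 'I_(#|gT| %/ l)].

Definition cyclotomic_coset (gT : finGroupType) (gamma : gT) (l i : nat) :
    {set gT} :=
  gamma ^+ i *: cyclotomic_coset0 gamma l.

(* When gamma generates gT and l is a positive divisor of #|gT|, the cosets of
   index i < l partition gT, so that this determines f from r and a. *)
Definition cyclotomic_mapping (gT : finGroupType) (gamma : gT) (l r : nat)
    (a : 'I_l -> gT) (f : gT -> gT) : Prop :=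
  forall (i : 'I_l) (x : gT), x \in cyclotomic_coset gamma l i ->
    f x = a i * x ^+ r.

Definition has_index (gT : finGroupType) (gamma : gT) (f : gT -> gT) (l : nat) :
    Prop :=
  exists (r : nat) (a : 'I_l -> gT),
    (0 < r)%N /\ cyclotomic_mapping gamma r a f.

Definition admissible_index (gT : finGroupType) (gamma : gT) (f : gT -> gT) :
    pred nat :=
  fun l => [&& (0 < l)%N, l %| #|gT| & `[< has_index gamma f l >]].

Lemma admissible_index_exists (gT : finGroupType) (gamma : gT) (f : gT -> gT) :
  exists l : nat, admissible_index gamma f l.
Proof.
have n_gt0 : (0 < #|gT|)%N by apply/card_gt0P; exists gamma.
exists #|gT|; apply/and3P; split; rewrite ?dvdnn //.
apply/asboolP; exists 1%N; exists (fun i => f (gamma ^+ i) * (gamma ^+ i)^-1).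
split=> // i x /lcosetP[y /imsetP[[j lt_j] _ ->] ->] /=.
move: lt_j; rewrite divnn n_gt0 ltnS leqn0 => /eqP->.
by rewrite mul0n expg0 mulg1 expg1 mulgKV.
Qed.

Definition ind (gT : finGroupType) (gamma : gT) (f : gT -> gT) : nat :=
  ex_minn (admissible_index_exists gamma f).

(* Main.v *)
(* Comparing exponents in d(gamma^(i + j l)) = a_i (gamma^(i + j l))^r for two
   values of i and of j (for three values of j if l = 1) forces n to divide 2 l,
   so l >= n / 2, and l = n if n is odd. If n = 2 l, then r = l works because
   (i + j l)^2 = (i^2 - l i) + l (i + j l) modulo n for j = 0, 1. *)
Require Import Defs.
From mathcomp Require Import all_boot all_fingroup all_solvable.
From mathcomp Require Import boolp zify.

Set Implicit Arguments.
Unset Strict Implicit.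
Unset Printing Implicit Defensive.

Local Open Scope group_scope.

Lemma mem_cyclotomic_coset (gT : finGroupType) (gamma : gT) (l i j : nat) :
  (j < #|gT| %/ l)%N -> gamma ^+ (i + j * l)%N \in cyclotomic_coset gamma l i.
Proof.
move=> lt_j; rewrite expgD mem_lcoset mulKg.
by apply/imsetP; exists (Ordinal lt_j).
Qed.

Section DiffieHellman.

Variables (gT : finGroupType) (gamma : gT) (d : gT -> gT).
Hypothesis order_gamma : #[gamma] = #|gT|.
Hypothesis dE : forall a : nat, d (gamma ^+ a) = gamma ^+ (a ^ 2)%N.

(** The point [gamma ^+ i] (the case [j = 0]) determines the coefficient [a i]; substituting it at
    [gamma ^+ (i + j * l)] leaves a congruence in [r] alone. *)
Lemma has_index_modn (l : nat) : has_index gamma d l ->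
  exists r : nat, forall i j : nat, (i < l)%N -> (j < #|gT| %/ l)%N ->
    ((i + j * l) ^ 2 = i ^ 2 + r * (j * l) %[mod #|gT|])%N.
Proof.
case=> r [a [_ da]]; exists r => i j lt_i lt_j.
have ai k : (k < #|gT| %/ l)%N ->
    gamma ^+ ((i + k * l) ^ 2)%N =
    a (Ordinal lt_i) * gamma ^+ ((i + k * l) * r)%N.
  by move=> /(@mem_cyclotomic_coset gT gamma l i k) /(da (Ordinal lt_i));
    rewrite dE -expgM.
have := ai 0%N (leq_ltn_trans (leq0n j) lt_j).
rewrite mul0n addn0 => /(canLR (mulgK _)) a_i.
apply/eqP; rewrite -order_gamma -eq_expg_mod_order ai // -a_i.
by rewrite mulnDl expgD mulgA mulgKV -expgD (mulnC r).
Qed.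

Lemma has_index_dvdn (l : nat) : (0 < l)%N -> l %| #|gT| ->
  has_index gamma d l -> (#|gT| %| 2 * l)%N.
Proof.
move=> l_gt0 l_dvd /has_index_modn[r sq_r].
have [m nE] := dvdnP l_dvd.
have m_gt0 : (0 < m)%N.
  have : (0 < #|gT|)%N by apply/card_gt0P; exists gamma.
  by rewrite nE muln_gt0 => /andP[].
have divE : (#|gT| %/ l)%N = m by rewrite nE mulnK.
rewrite {}divE in sq_r.
(* If [m = 1], cosets are single points and give no relation, but then [n = l]. *)
have [m_le1|m_gt1] := leqP m 1.
  by rewrite nE dvdn_pmul2r //; have -> : m = 1%N by lia.
have sq0 := sq_r 0%N 1%N l_gt0 m_gt1.
have [l_le1|l_gt1] := leqP l 1.
  have l1 : l = 1%N by lia.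
  (* Only [i = 0] is available here, so [j = 2] takes the place of [i = 1]: [j = 1] gives [r = 1]
     modulo [n], and then [j = 2] gives [4 = 2]. If [m = 2], then [n = 2] already. *)
  subst l; have [m_le2|m_gt2] := leqP m 2.
    by rewrite nE; have -> : m = 2 by lia.
  have /eqP := sq_r 0%N 2%N l_gt0 m_gt2.
  have r1 : r = 1%N %[mod #|gT|] by move: sq0; rewrite exp0n // !add0n !muln1 exp1n.
  rewrite exp0n // !add0n !muln1 -modnMml r1 modnMml mul1n.
  by rewrite (eqn_mod_dvd _ (_ : 2 <= 2 ^ 2)).
have sq1 := sq_r 1%N 1%N l_gt1 m_gt1.
(* [(1 + l)^2 = 1 + r l = 1 + l^2] modulo [n] *)
have /eqP : ((1 + 1 * l) ^ 2 = 1 + l ^ 2 %[mod #|gT|])%N.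
  rewrite sq1 exp1n -modnDmr; move: sq0; rewrite add0n exp0n // add0n => <-.
  by rewrite modnDmr mul1n.
have -> : ((1 + 1 * l) ^ 2 = 1 + l ^ 2 + 2 * l)%N by lia.
by rewrite eqn_mod_dvd ?leq_addr // addKn.
Qed.

Lemma has_index_half (l : nat) : (0 < l)%N -> #|gT| = (2 * l)%N ->
  has_index gamma d l.
Proof.
move=> l_gt0 nE.
exists l, (fun i : 'I_l => gamma ^+ (i ^ 2)%N * (gamma ^+ (i * l)%N)^-1).
split=> // i x /lcosetP[y /imsetP[[j /= lt_j] _ ->] ->].
rewrite nE mulnK // in lt_j.
rewrite -expgD dE -expgM mulnDl [in RHS]expgD mulgA mulgKV -expgD.
apply/eqP; rewrite eq_expg_mod_order order_gamma nE.
(* Cosets have two elements, so [j] is 0 or 1 and [j ^ 2 = j]; the cross term is a multiple of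
   [n]. *)
have -> : ((i + j * l) ^ 2 = i * j * (2 * l) + (i ^ 2 + j * l * l))%N.
  by case: j lt_j => [|[|]] //; lia.
by rewrite modnMDl.
Qed.

End DiffieHellman.

Theorem theorem1 (gT : finGroupType) (gamma : gT) (n : nat) (d : gT -> gT)
    (hgamma : generator [set: gT] gamma)
    (hn : #|gT| = n)
    (hn2 : (2 <= n)%N)
    (hd : forall a : nat, (a < n)%N -> d (gamma ^+ a) = gamma ^+ (a ^ 2)%N) :
  ind gamma d = if odd n then n else (n %/ 2)%N.
Proof.
have order_gamma : #[gamma] = #|gT| by rewrite /order -(eqP hgamma) cardsT.
(* The formula extends to all exponents because [a ^ 2] modulo [n] depends only on [a] modulo
   [n]. *)
have dE a : d (gamma ^+ a) = gamma ^+ (a ^ 2)%N.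
  have order_n : #[gamma] = n by rewrite order_gamma.
  rewrite -(expg_mod_order gamma a) order_n hd ?ltn_mod; last by lia.
  by apply/eqP; rewrite eq_expg_mod_order order_n modnXm.
rewrite /ind; case: ex_minnP => l /and3P[l_gt0 l_dvd /asboolP l_ind] l_min.
have := has_index_dvdn order_gamma dE l_gt0 l_dvd l_ind; rewrite hn in l_dvd *.
case: ifP => odd_n n_dvd.
  by apply/eqP; rewrite eqn_dvd l_dvd -(Gauss_dvdr _ (_ : coprime n 2)) // coprimen2.
have nE : n = (2 * (n %/ 2))%N by lia.
have half_gt0 : (0 < n %/ 2)%N by lia.
have half_le : (n <= 2 * l)%N by rewrite dvdn_leq // muln_gt0.
(* The lower bound is [half_le]; the upper one comes from minimality of [l]. *)
have : (l <= n %/ 2)%N; last by lia.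
apply/l_min/and3P; split=> //; first by rewrite hn {2}nE dvdn_mull.
by apply/asboolP/(has_index_half order_gamma dE); rewrite // hn.
Qed.
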